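(* Let $(X,\mathcal A,\sigma)$ be a measure space where $\sigma$ is a positive measure with $\sigma(X)<\infty$ and such that $\int_X|f|\,d\sigma=0$ implies $f=0$ $\sigma$-a.e., and let $\eta$ be a strictly positive measure on $[0,1]$. For membership functions $\mu,\nu:X\to[0,1]$ let \[ D(\mu,\nu)=\int_0^1\left(\int_X 1_{\mu^{-1}(\alpha,1]\,\Delta\,\nu^{-1}(\alpha,1]}(x)\,d\sigma(x)\right)d\eta(\alpha), \] and for hyperbolic-valued membership functions define \[ D_{\mathbb H}(M_{A_1,A_2},M_{B_1,B_2})=D(\mu_{A_1},\mu_{B_1})P+D(\mu_{A_2},\mu_{B_2})Q. \] Let $\mu_{A_1},\mu_{A_2},\mu_{B_1},\mu_{B_2},\mu_{C_1},\mu_{C_2}:X\to[0,1]$ and assume all integrals involved are well defined. Then \[ M_{A_1,A_2}(x)\wedge M_{B_1,B_2}(x)\le M_{C_1,C_2}(x)\le M_{A_1,A_2}(x)\vee M_{B_1,B_2}(x)\quad\text{for all }x\in X \] if and only if \[ D_{\mathbb H}(M_{A_1,A_2},M_{B_1,B_2})=D_{\mathbb H}(M_{A_1,A_2},M_{C_1,C_2})+D_{\mathbb H}(M_{C_1,C_2},M_{B_1,B_2}). \]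
   Context: $P=\frac12\begin{pmatrix}1&1\\1&1\end{pmatrix}$, $Q=\frac12\begin{pmatrix}1&-1\\-1&1\end{pmatrix}$ (so $\lambda_1P+\lambda_2Q=U\operatorname{diag}(\lambda_1,\lambda_2)U$ with $U=\frac1{\sqrt2}\begin{pmatrix}1&1\\1&-1\end{pmatrix}$). $M_{A_1,A_2}(x)=\mu_{A_1}(x)P+\mu_{A_2}(x)Q$, similarly for $B$, $C$. On matrices $\lambda_1P+\lambda_2Q$ the order is $S\le T$ iff $T-S$ is positive semi-definite, and $\wedge,\vee$ act componentwise: $(\lambda_1P+\lambda_2Q)\wedge(\mu_1P+\mu_2Q)=(\lambda_1\wedge\mu_1)P+(\lambda_2\wedge\mu_2)Q$, and likewise for $\vee$ with max. $\mu^{-1}(\alpha,1]=\{x:\alpha<\mu(x)\le1\}$ is the strong $\alpha$-cut and $\Delta$ the symmetric difference.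
   Formalization: The converse is false pointwise (change one membership function at a null point), so the equivalence is proved with betweenness for σ-a.e. x; the ''for all x'' version is proved when ∫|f|dσ=0 implies f=0 at every point. *)

(* Defs.v *)
From HB Require Import structures.
From mathcomp Require Import all_boot all_order all_algebra.
From mathcomp Require Import all_classical all_reals all_analysis.
From mathcomp Require Import ring.
Set Implicit Arguments.
Unset Strict Implicit.
Unset Printing Implicit Defensive.
Import Order.TTheory GRing.Theory Num.Theory.
Import numFieldNormedType.Exports.

Local Open Scope classical_set_scope.
Local Open Scope ring_scope.

Section Hyperbolic.
Context {R : realType}.

Definition hypP : 'M[R]_2 := 2^-1 *: const_mx 1.

Definition hypQ : 'M[R]_2 :=
  2^-1 *: \matrix_(i < 2, j < 2) (if i == j then 1 else -1).

Definition hyp (l1 l2 : R) : 'M[R]_2 := l1 *: hypP + l2 *: hypQ.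

(* The coefficients of S = l1 P + l2 Q are recovered from its first row
   ((l1 + l2) / 2, (l1 - l2) / 2); see hyp_coord1K and hyp_coord2K. *)
Definition hyp_coord1 (S : 'M[R]_2) : R := S 0 0 + S 0 1.
Definition hyp_coord2 (S : 'M[R]_2) : R := S 0 0 - S 0 1.

(* Only meaningful on matrices of the form l1 P + l2 Q; see hyp_meetE and
   hyp_joinE. *)
Definition hyp_meet (S T : 'M[R]_2) : 'M[R]_2 :=
  hyp (Num.min (hyp_coord1 S) (hyp_coord1 T))
      (Num.min (hyp_coord2 S) (hyp_coord2 T)).

Definition hyp_join (S T : 'M[R]_2) : 'M[R]_2 :=
  hyp (Num.max (hyp_coord1 S) (hyp_coord1 T))
      (Num.max (hyp_coord2 S) (hyp_coord2 T)).

Definition psdmx (n : nat) (S : 'M[R]_n) : Prop :=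
  S^T = S /\ forall v : 'cV[R]_n, 0 <= (v^T *m S *m v) 0 0.

Definition hyp_le (S T : 'M[R]_2) : Prop := psdmx (T - S).

Lemma hyp_coord1K (l1 l2 : R) : hyp_coord1 (hyp l1 l2) = l1.
Proof. by rewrite /hyp_coord1 !mxE /=; field. Qed.

Lemma hyp_coord2K (l1 l2 : R) : hyp_coord2 (hyp l1 l2) = l2.
Proof. by rewrite /hyp_coord2 !mxE /=; field. Qed.

Lemma hyp_meetE (l1 l2 m1 m2 : R) :
  hyp_meet (hyp l1 l2) (hyp m1 m2) = hyp (Num.min l1 m1) (Num.min l2 m2).
Proof. by rewrite /hyp_meet !hyp_coord1K !hyp_coord2K. Qed.

Lemma hyp_joinE (l1 l2 m1 m2 : R) :
  hyp_join (hyp l1 l2) (hyp m1 m2) = hyp (Num.max l1 m1) (Num.max l2 m2).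
Proof. by rewrite /hyp_join !hyp_coord1K !hyp_coord2K. Qed.

End Hyperbolic.

Section FuzzyDistance.
Context {d : measure_display} {X : measurableType d} {R : realType}.

Definition membership (mu : X -> R) : Prop := forall x, 0 <= mu x <= 1.

Definition hyp_membership (mu1 mu2 : X -> R) (x : X) : 'M[R]_2 :=
  hyp (mu1 x) (mu2 x).

Definition strong_cut (mu : X -> R) (a : R) : set X :=
  [set x | a < mu x <= 1].

(* `+` is the symmetric difference of sets. *)
Definition cut_symdiff (mu nu : X -> R) (a : R) : set X :=
  strong_cut mu a `+` strong_cut nu a.

Context (sigma : {measure set X -> \bar R}).

(* A measure on [0,1] is represented by a Borel measure on R of which only
   the restriction to [0,1] is ever used. *)
Context (eta : {measure set (measurableTypeR R) -> \bar R}).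

Definition strictly_positive01 : Prop :=
  forall U : set R, open U -> U `&` `[0, 1] !=set0 ->
    (0 < eta (U `&` `[0%R, 1%R]))%E.

Definition fuzzy_dist (mu nu : X -> R) : R :=
  \int[eta]_(a in `[0, 1]) (\int[sigma]_x \1_(cut_symdiff mu nu a) x).

(* The two integrals in fuzzy_dist exist and are finite, so that fuzzy_dist
   is not a default value. *)
Definition fuzzy_dist_defined (mu nu : X -> R) : Prop :=
  (forall a : R, 0 <= a <= 1 ->
     sigma.-integrable setT (EFin \o (\1_(cut_symdiff mu nu a) : X -> R))) /\
  eta.-integrable `[0, 1]
    (fun a => (\int[sigma]_x (\1_(cut_symdiff mu nu a) x : R))%:E).

Definition hyp_dist (muA1 muA2 muB1 muB2 : X -> R) : 'M[R]_2 :=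
  fuzzy_dist muA1 muB1 *: hypP + fuzzy_dist muA2 muB2 *: hypQ.

End FuzzyDistance.

(* Main.v *)
(* In the coordinates of P and Q both sides split into two scalar statements.
   For scalar membership functions A, B, C, the indicators of the cuts satisfy
     1_(A_a + C_a) + 1_(C_a + B_a) = 1_(A_a + B_a) + 2 * 1_(O_a),
   where + is the symmetric difference and O_a, the intersection of the two
   symmetric differences on the left, is the set of the x for which the level a
   separates C x from both A x and B x. Hence
     D(A, C) + D(C, B) = D(A, B) + 2 * \int sigma(O_a) d eta(a),
   and D is additive iff sigma(O_a) = 0 for eta-almost every a. As eta charges
   every interval, countably many of these null sets O_a cover the set where
   C x fails to lie between A x and B x. *)
Require Import Defs.
From mathcomp Require Import all_boot all_order all_algebra.
From mathcomp Require Import all_classical all_reals all_analysis.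
From mathcomp Require Import measurable_realfun ring lra.
Import Order.TTheory GRing.Theory Num.Theory.
Import numFieldNormedType.Exports.
Local Open Scope classical_set_scope.
Local Open Scope ring_scope.

(** * The semi-definite order in the coordinates of [hypP] and [hypQ] *)

Section HyperbolicOrder.
Context {R : realType}.

(** [hypP] and [hypQ] are the orthogonal projections onto the lines spanned by (1, 1) and (1, -1),
    so the quadratic form is diagonal in this basis. *)
Lemma hyp_quad (l1 l2 : R) (v : 'cV[R]_2) :
  (v^T *m hyp l1 l2 *m v) 0 0 =
  l1 / 2 * (v 0 0 + v 1 0) ^+ 2 + l2 / 2 * (v 0 0 - v 1 0) ^+ 2.
Proof.
rewrite !mxE !big_ord_recl big_ord0 !mxE !big_ord_recl !big_ord0 !mxE /=.
have -> : lift (0 : 'I_2) (0 : 'I_1) = 1 by apply/val_inj.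
by field.
Qed.

Lemma hyp_leE (l1 l2 m1 m2 : R) :
  hyp_le (hyp l1 l2) (hyp m1 m2) <-> l1 <= m1 /\ l2 <= m2.
Proof.
have hypB : hyp m1 m2 - hyp l1 l2 = hyp (m1 - l1) (m2 - l2).
  by rewrite /hyp !scalerBl opprD addrACA.
rewrite /hyp_le /psdmx hypB; split=> [[_ psd]|[l1m1 l2m2]].
(* Each of the vectors (1, 1) and (1, -1) kills one of the two squares and so isolates one
   coefficient. *)
- have := psd (\col_i 1); have := psd (\col_i (if i == 0 then 1 else -1)).
  rewrite !hyp_quad !mxE /=; lra.
- split; last first.
    by move=> v; rewrite hyp_quad addr_ge0// mulr_ge0// ?sqr_ge0//; lra.
  by apply/matrixP => i j; rewrite !mxE /= eq_sym.
Qed.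

Lemma hyp_inj (l1 l2 m1 m2 : R) :
  hyp l1 l2 = hyp m1 m2 -> l1 = m1 /\ l2 = m2.
Proof.
move=> e; split.
- by rewrite -(hyp_coord1K l1 l2) e hyp_coord1K.
- by rewrite -(hyp_coord2K l1 l2) e hyp_coord2K.
Qed.

End HyperbolicOrder.

(** * Pointwise combinatorics of the cuts *)

Section CutOverlap.
Context {d : measure_display} {X : measurableType d} {R : realType}.
Implicit Types A B C : X -> R.

Definition between A B C (x : X) : Prop :=
  Num.min (A x) (B x) <= C x <= Num.max (A x) (B x).

Definition cut_overlap A B C (a : R) : set X :=
  cut_symdiff A C a `&` cut_symdiff C B a.

Lemma cut_overlapE A B C (a : R) (x : X) :
  membership A -> membership B -> membership C ->
  cut_overlap A B C a x <->
  (C x <= a < Num.min (A x) (B x)) || (Num.max (A x) (B x) <= a < C x).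
Proof.
move=> mA mB mC; rewrite /cut_overlap /cut_symdiff /strong_cut /=.
have /andP[_ ->] := mA x; have /andP[_ ->] := mB x; have /andP[_ ->] := mC x.
rewrite lt_min ge_max !andbT.
by case: (ltP a (A x)); case: (ltP a (B x)); case: (ltP a (C x));
  move=> _ _ _ /=; intuition.
Qed.

Lemma between_cut_overlap A B C (x : X) :
  membership A -> membership B -> membership C ->
  between A B C x -> forall a, ~ cut_overlap A B C a x.
Proof.
move=> mA mB mC /andP[h1 h2] a /cut_overlapE-/(_ mA mB mC)/orP[]/andP[h3 h4].
- by have := le_lt_trans (le_trans h1 h3) h4; rewrite ltxx.
- by have := le_lt_trans h3 (lt_le_trans h4 h2); rewrite ltxx.
Qed.

(** Symmetric difference is exclusive or on indicators, and u + v = (u xor v) + 2uv for bits u, v;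
    the cut of [C] cancels in u xor v. *)
Lemma indic_cut_symdiffD A B C (a : R) (x : X) :
  \1_(cut_symdiff A C a) x + \1_(cut_symdiff C B a) x =
  \1_(cut_symdiff A B a) x + 2 * \1_(cut_overlap A B C a) x :> R.
Proof.
rewrite !indicE /cut_overlap in_setI /cut_symdiff.
have inY (S T : set X) : (x \in S `+` T) = (x \in S) (+) (x \in T).
  by rewrite setY_def in_setU !in_setD; case: (x \in S); case: (x \in T).
rewrite !inY.
case: (x \in strong_cut A a); case: (x \in strong_cut B a);
  case: (x \in strong_cut C a) => /=; ring.
Qed.

End CutOverlap.

(** * Integrating the overlap over points and levels *)

Section FuzzyDistanceExcess.
Context {d : measure_display} {X : measurableType d} {R : realType}.
Context (sigma : {measure set X -> \bar R}).
Context (eta : {measure set (measurableTypeR R) -> \bar R}).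
Context (A B C : X -> R).
Context (AB : fuzzy_dist_defined sigma eta A B).
Context (AC : fuzzy_dist_defined sigma eta A C).
Context (CB : fuzzy_dist_defined sigma eta C B).

Lemma measurable_cut_symdiff (mu nu : X -> R) (a : R) :
  fuzzy_dist_defined sigma eta mu nu -> 0 <= a <= 1 ->
  measurable (cut_symdiff mu nu a).
Proof.
move=> [h _] /h /integrableP[+ _] => /measurable_EFinP.
by move=> /measurable_indicP.
Qed.

Lemma measurable_cut_overlap (a : R) :
  0 <= a <= 1 -> measurable (cut_overlap A B C a).
Proof. by move=> a01; apply: measurableI; exact: measurable_cut_symdiff. Qed.

Lemma integrable_cut_overlap (a : R) : 0 <= a <= 1 ->
  sigma.-integrable setT (EFin \o (\1_(cut_overlap A B C a) : X -> R)).
Proof.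
move=> a01; have /= iAC := AC.1 a a01.
apply: (le_integrable measurableT _ _ iAC).
- apply/measurable_EFinP/measurable_indicP; exact: measurable_cut_overlap.
- move=> x _ /=; rewrite !ger0_norm // lee_fin !indicE /cut_overlap in_setI.
  by rewrite ler_nat; case: (_ \in _) => //=; case: (_ \in _).
Qed.

Definition cut_excess (a : R) : R := \int[sigma]_x \1_(cut_overlap A B C a) x.

Lemma cut_excess_ge0 (a : R) : 0 <= cut_excess a.
Proof. by apply: Rintegral_ge0 => x _. Qed.

Lemma cut_excess_eq0 (a : R) : 0 <= a <= 1 ->
  cut_excess a = 0 <-> sigma.-negligible (cut_overlap A B C a).
Proof.
move=> a01; have mO := measurable_cut_overlap a a01.
(* Finiteness matters here: [fine] would also send an infinite measure to 0. *)
have /(integrable_fin_num measurableT) := integrable_cut_overlap a a01.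
rewrite /cut_excess /Rintegral integral_indic// setIT => fin.
rewrite negligibleP//; split=> [e|->//].
by have := fineK fin; rewrite e => /esym.
Qed.

Lemma cut_excessE (a : R) : 0 <= a <= 1 ->
  \int[sigma]_x \1_(cut_symdiff A C a) x +
  \int[sigma]_x \1_(cut_symdiff C B a) x =
  \int[sigma]_x \1_(cut_symdiff A B a) x + 2 * cut_excess a :> R.
Proof.
move=> a01; have iO := integrable_cut_overlap a a01.
rewrite -RintegralZl// -!RintegralD//;
  [|exact: AB.1|exact: (integrableZl measurableT 2 iO)|exact: AC.1|exact: CB.1].
by apply: eq_Rintegral => x _; exact: indic_cut_symdiffD.
Qed.

(** Measurability in the level is obtained by solving [cut_excessE] for the excess: it is half of a
    combination of three functions integrable by assumption. *)
Lemma integrable_cut_excess :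
  eta.-integrable `[0, 1] (EFin \o cut_excess).
Proof.
have m01 : measurable (`[0, 1] : set (measurableTypeR R)).
  exact: measurable_itv.
have := integrableZl m01 2^-1
  (integrableB m01 (integrableD m01 AC.2 CB.2) AB.2).
apply: eq_integrable => // a; rewrite inE /= in_itv /= => a01.
by rewrite -EFinD cut_excessE//; congr EFin; field.
Qed.

Lemma fuzzy_dist_excess :
  fuzzy_dist sigma eta A C + fuzzy_dist sigma eta C B =
  fuzzy_dist sigma eta A B + 2 * \int[eta]_(a in `[0, 1]) cut_excess a.
Proof.
have m01 : measurable (`[0, 1] : set (measurableTypeR R)).
  exact: measurable_itv.
have iE := integrable_cut_excess.
rewrite /fuzzy_dist -RintegralZl// -!RintegralD//;
  [|exact: AB.2|exact: (integrableZl m01 2 iE)|exact: AC.2|exact: CB.2].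
apply: eq_Rintegral => a; rewrite inE /= in_itv /=; exact: cut_excessE.
Qed.

(** The excess is nonnegative, and its integral is finite, so the real value 0 is also the extended
    one. *)
Lemma cut_excess_ae_eq0 :
  \int[eta]_(a in `[0, 1]) cut_excess a = 0 ->
  {ae eta, forall a : R, 0 <= a <= 1 -> cut_excess a = 0}.
Proof.
have m01 : measurable (`[0, 1] : set (measurableTypeR R)).
  exact: measurable_itv.
have iE := integrable_cut_excess => e0.
have : (\int[eta]_(a in `[0%R, 1%R]) `|(EFin \o cut_excess) a| = 0)%E.
  under eq_integral => a _ do rewrite gee0_abs ?lee_fin ?cut_excess_ge0//.
  by rewrite -(fineK (integrable_fin_num m01 iE)); congr EFin.
move/(ae_eq_integral_abs eta m01 (measurable_int _ iE)).
apply: filterS => a /= h a01.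
by have /h[] : `[0, 1]%classic a by rewrite /= in_itv.
Qed.

End FuzzyDistanceExcess.

(** * Betweenness from additivity of the distance *)

Section Betweenness.
Context {d : measure_display} {X : measurableType d} {R : realType}.
Context (sigma : {measure set X -> \bar R}).
Context (eta : {measure set (measurableTypeR R) -> \bar R}).

(** Otherwise the open interval from [p] to [q] would lie in the exceptional null set, although
    [eta] charges it. *)
Lemma strictly_positive01_ae_meets (P : R -> Prop) (p q : R) :
  strictly_positive01 eta -> {ae eta, forall a : R, 0 <= a <= 1 -> P a} ->
  0 <= p -> p < q -> q <= 1 -> exists a, [/\ p < a, a < q & P a].
Proof.
move=> eta_pos aeP p0 pq q1; apply: contrapT => noa.
have sub : `]p, q[ `<=` `[0, 1]%classic.
  by move=> a; rewrite /= !in_itv /=; lra.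
have sub01 a : `]p, q[%classic a -> 0 <= a <= 1.
  by move=> /sub; rewrite /= in_itv.
have : (0 < eta (`]p, q[ `&` `[0%R, 1%R]))%E.
  apply: eta_pos; first exact: interval_open.
  exists ((p + q) / 2); split; last apply: sub; rewrite /= in_itv /=; lra.
rewrite setIidl// lt0e => /andP[/eqP + _]; apply.
apply/negligibleP; first exact: measurable_itv.
apply: negligibleS aeP => a pqa /= /(_ (sub01 _ pqa)) Pa; apply: noa; exists a.
by move: pqa; rewrite /= in_itv /= => /andP[].
Qed.

(* A level [a] separating [C x] from both [A x] and [B x] can be found in any
   interval with rational end points squeezed between them, so countably many
   good levels detect every failure of betweenness. *)
Lemma ae_between (A B C : X -> R) :
  strictly_positive01 eta ->
  membership A -> membership B -> membership C ->
  fuzzy_dist_defined sigma eta A B ->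
  fuzzy_dist_defined sigma eta A C ->
  fuzzy_dist_defined sigma eta C B ->
  {ae sigma, forall x, between A B C x} <->
  fuzzy_dist sigma eta A B =
    fuzzy_dist sigma eta A C + fuzzy_dist sigma eta C B.
Proof.
move=> eta_pos mA mB mC AB AC CB.
rewrite (fuzzy_dist_excess sigma eta A B C)//; split=> [btw|e].
  (* Every overlap lies in the null set where betweenness fails, so the excess vanishes at each
     level. *)
  have -> : \int[eta]_(a in `[0, 1]) cut_excess sigma A B C a = 0.
    rewrite /Rintegral integral0_eq// => a; rewrite /= in_itv /= => a01.
    congr EFin; apply/(cut_excess_eq0 sigma eta) => //.
    apply: negligibleS btw => x Ox /=.
    by move=> /(between_cut_overlap A B C x mA mB mC); apply; exact: Ox.
  by rewrite mulr0 addr0.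
have /cut_excess_ae_eq0 : \int[eta]_(a in `[0, 1]) cut_excess sigma A B C a = 0.
  lra.
move=> /(_ AB AC CB) ae0.
pose good (pq : rat * rat) (a : R) := [/\ ratr pq.1 < a, a < ratr pq.2 &
  sigma.-negligible (cut_overlap A B C a)].
have goodP (p q : rat) : 0 <= ratr p :> R -> p < q -> ratr q <= 1 :> R ->
    exists a, good (p, q) a.
  rewrite -(ltr_rat R) => p0 pq q1.
  have [a [pa aq a0]] :=
    strictly_positive01_ae_meets _ _ _ eta_pos ae0 p0 pq q1.
  by exists a; split=> //; apply/(cut_excess_eq0 sigma eta) => //; lra.
(* One good level is chosen per pair of rationals; pairs without one get the empty set, which keeps
   [lev] negligible. *)
pose lev pq : set X := if pselect (exists a, good pq a) is left h
  then cut_overlap A B C (sval (cid h)) else set0.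
have lev0 pq : sigma.-negligible (lev pq).
  rewrite /lev; case: pselect => [h|_]; last exact: negligible_set0.
  by case: cid => a /= [].
pose F n := if unpickle n is Some pq then lev pq else set0.
have FE pq : F (pickle pq) = lev pq by rewrite /F pickleK.
have F0 n : sigma.-negligible (F n).
  by rewrite /F; case: unpickle => [pq|] //; exact: negligible_set0.
have [N [mN N0 FN]] := negligible_bigcup F0.
exists N; split => //; apply: subset_trans FN => x /= /negP.
(* With rationals u < p < q < v, the level chosen for (p, q) lies between [u] and [v], so its
   overlap contains [x]. *)
have gap (u v : R) : 0 <= u -> u < v -> v <= 1 ->
    (forall a, u < a < v -> cut_overlap A B C a x) -> (\bigcup_n F n) x.
  move=> u0 uv v1 uvO.
  have [q /[!in_itv]/=/andP[uq qv]] := rat_in_itvoo uv.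
  have [p /[!in_itv]/=/andP[up pq]] := rat_in_itvoo uq.
  have [||| a0 Ha0] := goodP p q; [lra|by rewrite -(ltr_rat R)|lra|].
  suff lx : lev (p, q) x by exists (pickle (p, q)); [|rewrite FE].
  rewrite /lev; case: pselect => [h|[]]; last by exists a0.
  by case: cid => a /= [/= pa aq _]; apply: uvO; lra.
have /andP[A0 A1] := mA x; have /andP[B0 B1] := mB x; have /andP[C0 C1] := mC x.
rewrite negb_and -!ltNge => /orP[lo|hi].
- apply: (gap (C x) (Num.min (A x) (B x))) => //; first by rewrite ge_min A1.
  by move=> a /andP[/ltW h1 h2]; apply/cut_overlapE => //; rewrite h1 h2.
- apply: (gap (Num.max (A x) (B x)) (C x)) => //; first by rewrite le_max A0.
  by move=> a /andP[/ltW h1 h2]; apply/cut_overlapE => //; rewrite h1 h2 orbT.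
Qed.

End Betweenness.

(** The hypothesis, applied to the indicator of a measurable null set covering [N], makes that set
    empty. *)
Lemma negligible_eq_set0 (R : realType) (d : measure_display)
    (X : measurableType d) (sigma : {measure set X -> \bar R}) (N : set X) :
  (forall f : X -> R, measurable_fun setT f ->
     (\int[sigma]_x `|f x|%:E = 0)%E -> forall x, f x = 0) ->
  sigma.-negligible N -> N = set0.
Proof.
move=> faithful [M [mM M0 NM]]; rewrite -subset0 => x /NM Mx.
have : \1_M x = 0 :> R.
  apply: faithful; first exact: measurable_indic.
  under eq_integral => y _ do rewrite ger0_norm//.
  by rewrite integral_indic// setIT.
by rewrite indicE mem_set// => /eqP; rewrite oner_eq0.
Qed.

(** The distances see membership functions only up to [sigma]-null sets, hence betweenness almost
    everywhere in the first part. The second part reads f = 0 at every point, which leaves no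
    nonempty null set. *)
Theorem theorem11p6 (R : realType) (d : measure_display) (X : measurableType d)
  (sigma : {measure set X -> \bar R})
  (eta : {measure set (measurableTypeR R) -> \bar R})
  (muA1 muA2 muB1 muB2 muC1 muC2 : X -> R)
  (sigma_finite_mass : (sigma setT < +oo)%E)
  (sigma_ae : forall f : X -> R, measurable_fun setT f ->
     (\int[sigma]_x `|f x|%:E = 0)%E -> {ae sigma, forall x, f x = 0})
  (eta_pos : strictly_positive01 eta)
  (mA1 : membership muA1) (mA2 : membership muA2)
  (mB1 : membership muB1) (mB2 : membership muB2)
  (mC1 : membership muC1) (mC2 : membership muC2)
  (AB1 : fuzzy_dist_defined sigma eta muA1 muB1)
  (AB2 : fuzzy_dist_defined sigma eta muA2 muB2)
  (AC1 : fuzzy_dist_defined sigma eta muA1 muC1)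
  (AC2 : fuzzy_dist_defined sigma eta muA2 muC2)
  (CB1 : fuzzy_dist_defined sigma eta muC1 muB1)
  (CB2 : fuzzy_dist_defined sigma eta muC2 muB2) :
  let MA := hyp_membership muA1 muA2 in
  let MB := hyp_membership muB1 muB2 in
  let MC := hyp_membership muC1 muC2 in
  let between := fun x : X =>
    hyp_le (hyp_meet (MA x) (MB x)) (MC x) /\
    hyp_le (MC x) (hyp_join (MA x) (MB x)) in
  let dist_additive :=
    hyp_dist sigma eta muA1 muA2 muB1 muB2 =
    hyp_dist sigma eta muA1 muA2 muC1 muC2 +
    hyp_dist sigma eta muC1 muC2 muB1 muB2 in
  ({ae sigma, forall x, between x} <-> dist_additive) /\
  ((forall f : X -> R, measurable_fun setT f ->
      (\int[sigma]_x `|f x|%:E = 0)%E -> forall x, f x = 0) ->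
   ((forall x, between x) <-> dist_additive)).
Proof.
move=> MA MB MC btw dist_additive.
have btwE x : btw x <-> between muA1 muB1 muC1 x /\ between muA2 muB2 muC2 x.
  rewrite /btw /MA /MB /MC /hyp_membership hyp_meetE hyp_joinE !hyp_leE.
  split=> [[[? ?] [? ?]]|[/andP[? ?] /andP[? ?]]]; last by split; split.
  by split; apply/andP.
have aeE : {ae sigma, forall x, btw x} <-> dist_additive.
  have additiveE : dist_additive <->
      fuzzy_dist sigma eta muA1 muB1 =
        fuzzy_dist sigma eta muA1 muC1 + fuzzy_dist sigma eta muC1 muB1 /\
      fuzzy_dist sigma eta muA2 muB2 =
        fuzzy_dist sigma eta muA2 muC2 + fuzzy_dist sigma eta muC2 muB2.
    have -> : dist_additive = (hyp (fuzzy_dist sigma eta muA1 muB1)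
        (fuzzy_dist sigma eta muA2 muB2) =
      hyp (fuzzy_dist sigma eta muA1 muC1 + fuzzy_dist sigma eta muC1 muB1)
        (fuzzy_dist sigma eta muA2 muC2 + fuzzy_dist sigma eta muC2 muB2)).
      by rewrite /dist_additive /hyp_dist addrACA -!scalerDl.
    by split=> [/hyp_inj|[-> ->]].
  rewrite additiveE -!ae_between//; split=> [h|[h1 h2]].
  - by split; apply: filterS h => x /btwE[].
  - by apply: filterS2 h1 h2 => x h1 h2; apply/btwE.
split=> // faithful; rewrite -aeE; split=> [|h]; first exact: aeW.
have N0 := negligible_eq_set0 _ _ _ _ _ faithful h.
move=> x; apply: contrapT => nbx.
by have : (~` btw) x by []; rewrite [X in X x]N0.
Qed.
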